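(* Let $(X_n,d_n)$, $n\in\mathbb{N}$, be a sequence of bounded Lorentzian metric spaces GH-convergent (in the sense of bounded Lorentzian metric spaces) to a bounded Lorentzian metric space $(X,d)$. Suppose that for each $n$ the subset $I(X_n)$ is dense in $X_n$, and similarly that $I(X)$ is dense in $X$, and let $\{p^k\}_{k\in\mathbb{N}}$ be a generating sequence of $I(X)$. Then there are generating sequences $\{p_n^k\}_{k\in\mathbb{N}}$ of $I(X_n)$ (for each $n\in\mathbb{N}$) such that the sequence of sequenced Lorentzian metric spaces $(I(X_n),d_n,\{p_n^k\}_{k\in\mathbb{N}})$ GH-converges to $(I(X),d,\{p^k\}_{k\in\mathbb{N}})$, where $d_n$ and $d$ are restricted to $I(X_n)$ and $I(X)$.
   Context: Let $X$ be a set and $d:X\times X\to[0,+\infty)$ a function. Notation: $x\ll y$ iff $d(x,y)>0$; $I^+(x)=\{y: x\ll y\}$, $I^-(x)=\{y: y\ll x\}$; for $A\subset X$, $I^\pm(A)=\bigcup_{p\in A}I^\pm(p)$ and $I(A)=I^+(A)\cap I^-(A)$ (so $I(X)$ is the set of points having both a point $\ll$ before and a point $\ll$ after them); $I(p^1,\dots,p^m):=I(\{p^1,\dots,p^m\})$. For $\epsilon>0$, $I_\epsilon=\{(x,y): d(x,y)\ge\epsilon\}$ and $I_\epsilon(p^1,\dots,p^m)=\{x: \exists i,j\in\{1,\dots,m\},\ d(p^i,x)\ge\epsilon,\ d(x,p^j)\ge\epsilon\}$. $(X,d)$ is a Lorentzian metric space if: (i) $d(x,z)\ge d(x,y)+d(y,z)$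 whenever $d(x,y)>0$ and $d(y,z)>0$; (ii) there is a topology $T$ on $X$ such that $d$ is continuous in the product topology and, for every $x,y\in X$ and $\epsilon>0$, the set $I_\epsilon\cap(\overline{I(x,y)}\times\overline{I(x,y)})$ is compact; (iii) for all $x\ne y$ there is $z\in X$ with $d(x,z)\ne d(y,z)$ or $d(z,x)\ne d(z,y)$. It is a bounded Lorentzian metric space if (i) and (iii) hold and (ii) is replaced by: there is a topology on $X$ such that $d$ is continuous in the product topology and $I_\epsilon$ is compact for every $\epsilon>0$. A bounded Lorentzian metric space is endowed with the coarsest such topology, which is the one with subbasis the sets $\{q: a<d(p,q)<b\}\cap\{q: c<d(q,r)<e\}$, $p,r\in X$, $a,b,c,e\in[-\infty,\infty]$. A generating sequence of a Lorentzian metric space $X$ is a sequence $\{p^k\}_{k\in\mathbb{N}}$ in $X$ with $I(\{p^k\})=X$; $(X,d,\{p^k\})$ is then a sequenced Lorentzian metric space, the topology in (ii) is unique and $X$ is endowed with it. If $X$ is bounded and $I(X)$ is dense in $X$, then $I(X)$ with the restricted distance is a Lorentzian metric space admitting generating sequences (generation being understood inside $I(X)$). For a relation $R\subset X\times X'$ between spaces with distances $d,d'$, $R_1\subset X$, $R_2\subset X'$ denote its projections; $R$ is a correspondence if $R_1=X$, $R_2=X'$; $\mathrm{dis}\,R=\sup_{(x,x'),(y,y')\in R}|d(x,y)-d'(x',y')|$. Bounded Lorentzian metric spaces $(X_n,d_n)$ GH-converge to $(X,d)$ if there are correspondences $R_n\subset X_n\times X$ with $\mathrm{dis}\,R_n\to0$.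 For a sequenced space, $X^m:=\overline{I(p^1,\dots,p^m)}\cup\{p^1,\dots,p^m\}$. For $m\in\mathbb{N}$, $\epsilon>0$, an $(m,\epsilon)$ $X$–$X'$ quasi-correspondence between $(X,d,\{p^k\})$ and $(X',d',\{p'^k\})$ is a compact set $R\subset X^m\times X'^m$ with $I_\epsilon(p^1,\dots,p^m)\subset R_1$, $I_\epsilon(p'^1,\dots,p'^m)\subset R_2$, $\mathrm{dis}\,R<\epsilon$, and $(p^r,p'^r)\in R$ for $r=1,\dots,m$. A sequence of sequenced spaces $(X_n,d_n,\{p_n^k\}_k)$ GH-converges to $(X,d,\{p^k\}_k)$ if for every $m\in\mathbb{N}$ and $\delta>0$ there is $n_0$ such that for every $n\ge n_0$ there exists an $(m,\delta)$ $X_n$–$X$ quasi-correspondence. *)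

(* Defs.v *)
From HB Require Import structures.
From mathcomp Require Import all_boot all_order all_algebra.
From mathcomp Require Import all_classical all_reals all_analysis.
Set Implicit Arguments.
Unset Strict Implicit.
Unset Printing Implicit Defensive.
Import Order.TTheory GRing.Theory Num.Theory.
Import numFieldNormedType.Exports.
Local Open Scope classical_set_scope.
Local Open Scope ring_scope.

(* Topologies on a fixed set are first-class here, because the axioms of
   Lorentzian metric spaces quantify over them.  [topologized T] is X with the
   topologicalType structure whose open sets are those of T. *)
Record topology (X : Type) := Topology {
  opens :> set (set X) ;
  opensT : opens setT ;
  opensI : forall A B, opens A -> opens B -> opens (A `&` B) ;
  opens_bigcup : forall F : set (set X), F `<=` opens ->
    opens (\bigcup_(A in F) A) }.

Definition topologized (X : Type) (T : topology X) : Type := X.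

Lemma opens_bigU (X : Type) (T : topology X) (I : Type) (f : I -> set X) :
  (forall i, opens T (f i)) -> opens T (\bigcup_i f i).
Proof.
move=> fT; have -> : \bigcup_i f i = \bigcup_(A in range f) A.
  by rewrite bigcup_image.
by apply: opens_bigcup => _ [i _ <-].
Qed.

HB.instance Definition _ (X : Type) (T : topology X) :=
  gen_eqMixin (topologized T).
HB.instance Definition _ (X : Type) (T : topology X) :=
  gen_choiceMixin (topologized T).
HB.instance Definition _ (X : Type) (T : topology X) :=
  isOpenTopological.Build (topologized T)
    (opensT T) (@opensI X T) (@opens_bigU X T).

(* The topology of the sets that are open for every topology in P.  If P has a
   coarsest element, this is that element. *)
Section meet_topology.
Context {X : Type} (P : set (topology X)).
Let op : set (set X) := [set A | forall T, P T -> opens T A].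

Let opT : op setT. Proof. by move=> T _; exact: opensT. Qed.

Let opI A B : op A -> op B -> op (A `&` B).
Proof. by move=> oA oB T PT; apply: opensI; [exact: oA|exact: oB]. Qed.

Let op_bigcup (F : set (set X)) : F `<=` op -> op (\bigcup_(A in F) A).
Proof. by move=> Fo T PT; apply: opens_bigcup => A FA; exact: (Fo A). Qed.

Definition meet_topology : topology X := Topology opT opI op_bigcup.
End meet_topology.

Section lorentzian.
Context {R : realType} {X : Type}.
Implicit Types (d : X -> X -> R) (A : set X) (T : topology X) (p : nat -> X).

Definition chron d (x y : X) : Prop := 0 < d x y.

Definition Iplus d A : set X := [set y | exists2 x, A x & chron d x y].
Definition Iminus d A : set X := [set y | exists2 x, A x & chron d y x].
Definition Iset d A : set X := Iplus d A `&` Iminus d A.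

Definition Ieps d (e : R) : set (X * X) := [set z | e <= d z.1 z.2].

Definition Ieps_of d (e : R) A : set X :=
  [set x | exists y z, [/\ A y, A z, e <= d y x & e <= d x z]].

Definition reverse_triangle d : Prop :=
  forall x y z, 0 < d x y -> 0 < d y z -> d x y + d y z <= d x z.

Definition distinguishing d : Prop :=
  forall x y, x <> y -> exists z, d x z <> d y z \/ d z x <> d z y.

Definition continuous_dist d T : Prop :=
  continuous (fun z : topologized T * topologized T => d z.1 z.2).

Definition closure_in T A : set X := closure (A : set (topologized T)).

Definition lms_admissible d : set (topology X) := [set T |
  continuous_dist d T /\
  forall (x y : X) (e : R), 0 < e ->
    let K := closure_in T (Iset d [set x; y]) in
    compact (Ieps d e `&` (K `*` K) : set (topologized T * topologized T))].

Definition bounded_admissible d : set (topology X) := [set T |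
  continuous_dist d T /\
  forall e : R, 0 < e ->
    compact (Ieps d e : set (topologized T * topologized T))].

Definition lorentzian_metric_space d : Prop :=
  [/\ forall x y, 0 <= d x y, reverse_triangle d,
      exists T, lms_admissible d T & distinguishing d].

Definition bounded_lorentzian_metric_space d : Prop :=
  [/\ forall x y, 0 <= d x y, reverse_triangle d,
      exists T, bounded_admissible d T & distinguishing d].

(* The coarsest admissible topology of a bounded Lorentzian metric space. *)
Definition bounded_topology d : topology X :=
  meet_topology (bounded_admissible d).

Definition generating d p : Prop := Iset d (range p) = setT.

Definition sequenced_lorentzian_metric_space d p : Prop :=
  lorentzian_metric_space d /\ generating d p.

(* A sequenced space has exactly one admissible topology, so the meet is that
   topology. *)
Definition lms_topology d : topology X := meet_topology (lms_admissible d).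

(* The points p^1, ..., p^m are p 0, ..., p (m - 1). *)
Definition first_points p (m : nat) : set X := p @` `I_m.

Definition Xm d p (m : nat) : set X :=
  closure_in (lms_topology d) (Iset d (first_points p m)) `|` first_points p m.

(* The chronological interior I(X), with the restricted distance. *)
Definition chron_interior d : set X := Iset d setT.

Definition restricted_dist d (x y : chron_interior d) : R :=
  d (set_val x) (set_val y).

End lorentzian.
Arguments restricted_dist {R X} d x y.

Section gromov_hausdorff.
Context {R : realType}.

Definition correspondence (X X' : Type) (S : set (X * X')) : Prop :=
  fst @` S = setT /\ snd @` S = setT.

(* The supremum is taken in [0, +oo]; in particular it is 0 for S = set0,
   whereas ereal_sup set0 = -oo. *)
Definition dis (X X' : Type) (d : X -> X -> R) (d' : X' -> X' -> R)
    (S : set (X * X')) : \bar R :=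
  maxe 0%E (ereal_sup [set r : \bar R | exists z w,
    [/\ S z, S w & r = (`|d z.1 w.1 - d' z.2 w.2|)%:E]]).

Definition bounded_GH_converges
    (X_ : nat -> Type) (d_ : forall n, X_ n -> X_ n -> R)
    (X : Type) (d : X -> X -> R) : Prop :=
  exists S : forall n, set (X_ n * X),
    (forall n, correspondence (S n)) /\
    dis (@d_ n) d (S n) @[n --> \oo] --> 0%E.

Definition quasi_correspondence (X X' : Type)
    (d : X -> X -> R) (p : nat -> X) (d' : X' -> X' -> R) (p' : nat -> X')
    (m : nat) (e : R) (S : set (X * X')) : Prop :=
  [/\ compact (S : set (topologized (lms_topology d) *
                        topologized (lms_topology d'))) /\
        S `<=` Xm d p m `*` Xm d' p' m,
      Ieps_of d e (first_points p m) `<=` fst @` S,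
      Ieps_of d' e (first_points p' m) `<=` snd @` S,
      (dis d d' S < e%:E)%E
    & forall r, (r < m)%N -> S (p r, p' r)].

Definition sequenced_GH_converges
    (X_ : nat -> Type) (d_ : forall n, X_ n -> X_ n -> R)
    (p_ : forall n, nat -> X_ n)
    (X : Type) (d : X -> X -> R) (p : nat -> X) : Prop :=
  forall (m : nat) (e : R), 0 < e ->
    exists n0 : nat, forall n, (n0 <= n)%N ->
      exists S : set (X_ n * X),
        quasi_correspondence (@d_ n) (p_ n) d p m e S.

End gromov_hausdorff.

(* Main.v *)
(* Each d(x, .) is uniformly close to d(x', .) for x' near x in the coarsest
   topology, by compactness of the sets I_epsilon; so density of I(X_n) allows to
   move an S_n-partner of p^k into I(X_n) with a uniform error 1 / (n + 1).  The
   resulting points are the first n terms of p_n; the remaining terms are any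
   generating sequence of I(X_n), which exists because I_{1/k} is covered by
   finitely many sets I^+(u) x I^-(v).  The (m, e) quasi-correspondence consists
   of the pairs of points of I_{e/2}(p_n^1, ..., p_n^m) x I_{e/2}(p^1, ..., p^m)
   whose distances to the pairs of S_n agree up to e / 4, a closed condition,
   together with the pairs (p_n^r, p^r): comparing through S_n bounds its
   distortion by 3e/4.  By the reverse triangle inequality the closures involved
   stay inside the chronological interior, so compactness is inherited from the
   ambient bounded spaces. *)
Require Import Defs.
From HB Require Import structures.
From mathcomp Require Import all_boot all_order all_algebra.
From mathcomp Require Import all_classical all_reals all_analysis.
From mathcomp Require Import lra.
Set Implicit Arguments.
Unset Strict Implicit.
Unset Printing Implicit Defensive.
Import Order.TTheory GRing.Theory Num.Theory.
Import numFieldNormedType.Exports.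
Local Open Scope classical_set_scope.
Local Open Scope ring_scope.

(** * Compactness, continuity and closedness in general topological spaces *)

Lemma compact_finite_cover (T : topologicalType) (I : eqType) (K : set T)
    (f : I -> set T) :
  compact K -> (forall i, open (f i)) -> (forall x, K x -> exists i, f i x) ->
  exists s : seq I, forall x, K x -> exists2 i, i \in s & f i x.
Proof.
move=> /compact_near_coveringP cK of_ Kf.
(* In this filter a property holds eventually when it holds for all lists containing some fixed
   list. Near-covering compactness along it yields one finite list good for all of [K]. *)
pose F : set_system (seq I) :=
  fun A => exists s : seq I, forall t, {subset s <= t} -> A t.
have FF : Filter F.
  split; first by exists [::].
  - move=> A B [s sA] [t tB]; exists (s ++ t) => u stu; split.
      by apply: sA => i si; apply: stu; rewrite mem_cat si.
    by apply: tB => i ti; apply: stu; rewrite mem_cat ti orbT.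
  - by move=> A B AB [s sA]; exists s => t /sA /AB.
have [|s sP] := cK _ F (fun s x => exists2 i, i \in s & f i x) FF.
  move=> x /Kf[i fix_].
  exists (f i, [set t : seq I | i \in t]); first split => /=.
  - by apply: open_nbhs_nbhs; split => //; exact: of_.
  - by exists [:: i] => t; apply; rewrite mem_head.
  - by move=> [y t] [/= fy it]; exists i.
by exists s => x Kx; apply: (sP s).
Qed.

Lemma continuous_fst_comp (S T U : topologicalType) (f : S -> U) :
  continuous f -> continuous (fun z : S * T => f z.1).
Proof. by move=> cf z; exact: (@continuous_comp _ _ _ fst f z cvg_fst (cf _)). Qed.

Lemma continuous_snd_comp (S T U : topologicalType) (f : T -> U) :
  continuous f -> continuous (fun z : S * T => f z.2).
Proof. by move=> cf z; exact: (@continuous_comp _ _ _ snd f z cvg_snd (cf _)). Qed.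

Lemma closed_dist_le_comp (R : realType) (S : topologicalType) (f g : S -> R)
    (a : R) :
  continuous f -> continuous g -> closed [set s | `|f s - g s| <= a].
Proof.
move=> cf cg; apply: (@preimage_closed _ _ (fun s => `|f s - g s|) [set r | r <= a]).
  by move=> s _; apply: cvg_norm; apply: cvgB; [exact: cf|exact: cg].
exact: closed_le.
Qed.

Lemma open_gt_comp (R : realType) (S : topologicalType) (f : S -> R) (a : R) :
  continuous f -> open [set s | a < f s].
Proof. by move=> /continuousP /(_ _ (@open_gt R a)). Qed.

Lemma closed_setX (S T : topologicalType) (A : set S) (B : set T) :
  closed A -> closed B -> closed (A `*` B).
Proof.
move=> cA cB; have -> : A `*` B = (fst @^-1` A) `&` (snd @^-1` B) by [].
apply: closedI.
  by apply: (@preimage_closed _ _ fst) => // z _; exact: cvg_fst.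
by apply: (@preimage_closed _ _ snd) => // z _; exact: cvg_snd.
Qed.

Lemma closed_ge_comp (R : realType) (S : topologicalType) (f : S -> R) (a : R) :
  continuous f -> closed [set s | a <= f s].
Proof.
by move=> cf; apply: (@preimage_closed _ _ f [set r | a <= r]) => // s _; exact: cf.
Qed.

(** * Comparison and pullback of topologies *)

Lemma nbhs_coarser (X : Type) (T T' : topology X) (x : X) :
  opens T' `<=` opens T ->
  nbhs (x : topologized T') `<=` nbhs (x : topologized T).
Proof.
move=> TT' A; rewrite !nbhsE => -[B [oB Bx] BA]; exists B => //.
by split=> //; exact: TT'.
Qed.

Section preimage_topology.
Context {X Y : Type} (f : Y -> X) (T : topology X).
Let op : set (set Y) := [set A | exists2 U, opens T U & A = f @^-1` U].

Let opT : op setT. Proof. by exists setT; first exact: opensT. Qed.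

Let opI A B : op A -> op B -> op (A `&` B).
Proof.
move=> [U oU ->] [V oV ->]; exists (U `&` V); first exact: opensI.
by rewrite preimage_setI.
Qed.

Let op_bigcup (F : set (set Y)) : F `<=` op -> op (\bigcup_(A in F) A).
Proof.
(* Taking every open [U] whose preimage belongs to [F] avoids choosing one for each member of
   [F]. *)
move=> Fo; exists (\bigcup_(U in [set U | opens T U /\ F (f @^-1` U)]) U).
  by apply: opens_bigcup => U [].
apply/seteqP; split=> [y [A FA Ay]|y [U [oU FU] Uy]]; last by exists (f @^-1` U).
by have [U oU AU] := Fo _ FA; exists U; [split; rewrite -?AU|rewrite AU in Ay].
Qed.

Definition preimage_topology : topology Y := Topology opT opI op_bigcup.

Lemma continuous_preimage_topology :
  continuous (f : topologized preimage_topology -> topologized T).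
Proof. by apply/continuousP => U oU; exists U. Qed.

End preimage_topology.

(* S and S' may be strictly coarser than the topologies induced by f and f'. *)
Lemma compact_preimage2 (X X' Y Y' : Type) (f : Y -> X) (f' : Y' -> X')
    (T : topology X) (T' : topology X') (S : topology Y) (S' : topology Y')
    (K : set (X * X')) :
  opens S `<=` opens (preimage_topology f T) ->
  opens S' `<=` opens (preimage_topology f' T') ->
  K `<=` range f `*` range f' ->
  compact (K : set (topologized T * topologized T')) ->
  compact ([set z | K (f z.1, f' z.2)] : set (topologized S * topologized S')).
Proof.
move=> Sf Sf' Kf cK F FF FK.
pose g (z : topologized S * topologized S') : topologized T * topologized T' :=
  (f z.1, f' z.2).
have [[x x'] [Kz clz]] := cK (g @ F) _ FK.
have [[y _ yx] [y' _ y'x]] := Kf _ Kz; rewrite /= in yx y'x.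
exists (y, y'); split; first by rewrite /= yx y'x.
move=> A B FA [[N N'] /= [/(nbhs_coarser Sf) nN /(nbhs_coarser Sf') nN'] NN'B].
move: nN nN'; rewrite !nbhsE => -[_ [[U oU ->] Uy] UN] [_ [[U' oU' ->] Uy'] UN'].
have FgA : F (g @^-1` (g @` A)) by apply: filterS FA => a Aa; exists a.
have [||w [[[a a'] Aa gw] [Uw Uw']]] := clz (g @` A) (U `*` U').
- exact: FgA.
- exists (U, U') => //; split; apply: open_nbhs_nbhs; split => //=.
    by rewrite -yx.
  by rewrite -y'x.
- move: Uw Uw'; rewrite -gw => Ua Ua'; exists (a, a'); split => //.
  by apply: NN'B; split; [exact: UN|exact: UN'].
Qed.

(** * The coarsest topology of a bounded space and uniform approximation *)

Section bounded.
Context {R : realType} {X : Type}.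
Implicit Types (d : X -> X -> R) (T : topology X).

Lemma continuous_dist_comp d T (S : topologicalType) (f g : S -> topologized T) :
  continuous_dist d T -> continuous f -> continuous g ->
  continuous (fun s => d (f s) (g s)).
Proof.
move=> cd cf cg s.
apply: (@continuous_comp _ _ _ (fun s => (f s, g s)) (fun z => d z.1 z.2)).
  exact: (cvg_pair (cf s) (cg s)).
exact: cd.
Qed.

Lemma continuous_distl d T (z : X) : continuous_dist d T ->
  continuous (fun x : topologized T => d x z).
Proof.
move=> cd; apply: (@continuous_dist_comp d T _ id (fun=> z)) => //.
  by move=> x; exact: cvg_id.
exact: cst_continuous.
Qed.

Lemma bounded_topology_continuous_distl d (z : X) :
  continuous (fun x : topologized (bounded_topology d) => d x z).
Proof.
apply/continuousP => A oA.
suff : opens (bounded_topology d) ((fun x => d x z) @^-1` A) by [].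
move=> T [cd _]; have /continuousP := @continuous_distl d T z cd.
by move=> /(_ A oA).
Qed.

(** Time reversal: results on one argument of [d] transfer to the other. *)
Lemma bounded_admissible_flip d T :
  bounded_admissible d T -> bounded_admissible (fun x y => d y x) T.
Proof.
move=> [cd cI]; split=> [|e e0].
  apply: (@continuous_dist_comp d T _ snd fst) => //.
    by move=> z; exact: cvg_snd.
  by move=> z; exact: cvg_fst.
have -> : Ieps (fun x y => d y x) e = (fun z => (z.2, z.1)) @` Ieps d e.
  apply/seteqP; split=> [[x y] /= xy|_ [[x y] /= xy <-]//].
  by exists (y, x).
apply: continuous_compact (cI e e0).
by apply: continuous_subspaceT => z; exact: swap_continuous.
Qed.

Lemma bounded_topology_flip d :
  bounded_topology (fun x y => d y x) = bounded_topology d.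
Proof.
congr meet_topology; apply/seteqP; split=> T; last exact: bounded_admissible_flip.
exact: (@bounded_admissible_flip (fun x y => d y x)).
Qed.

(** If d(x',z) or d(x,z) is at least e, then z is the second component of a pair in the compact set
    [Ieps d e], over which continuity is uniform. Otherwise both numbers lie in [0,e). *)
Lemma near_dist_uniform d T (x : X) (e : R) : (forall x y, 0 <= d x y) ->
  bounded_admissible d T -> 0 < e ->
  \forall x' \near (x : topologized T), forall z, `|d x' z - d x z| < e.
Proof.
move=> d0 [cd cI] e0.
have e20 : 0 < e / 2 by lra.
have /compact_near_coveringP cov := cI e e0.
pose P (x' : topologized T) (w : topologized T * topologized T) :=
  `|d x' w.2 - d x w.2| < e.
have : \forall x' \near (x : topologized T), Ieps d e `<=` P x'.
  apply: (cov _ _ P (nbhs_filter (x : topologized T))) => -[y z] /= _.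
  (* Continuity is used at (x,z), not at (y,z): only the second component of the pair matters, and
     d(x',z') and d(x,z') are both within e/2 of d(x,z). *)
  have /cvgrPdist_lt/(_ _ e20)[[A B] /= [nA nB] AB] := cd (x, z).
  exists (setT `*` B, A); first split=> //=.
    by exists (setT, B) => //=; split=> //; exact: filterT.
  move=> [[y' z'] x'] [/= [_ Bz'] Ax'].
  have := AB (x', z') (conj Ax' Bz').
  have := AB (x, z') (conj (nbhs_singleton nA) Bz').
  by rewrite /P /= !ltr_norml; lra.
apply: filterS => x' Px' z.
have [xz|xz] := leP e (d x' z); first exact: (Px' (x', z)).
have [xz'|xz'] := leP e (d x z); first exact: (Px' (x, z)).
by have := d0 x z; have := d0 x' z; rewrite ltr_norml; lra.
Qed.

(** Points without disjoint neighbourhoods have equal images under every continuous real function,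
    in particular under all d(.,z) and d(z,.), which separate points. *)
Lemma bounded_topology_hausdorff d : distinguishing d ->
  hausdorff_space (topologized (bounded_topology d)).
Proof.
move=> dist x y clxy.
have fxy (f : topologized (bounded_topology d) -> R) : continuous f -> f x = f y.
  move=> cf; apply: (@Rhausdorff R) => U V fU fV.
  by have [w [Uw Vw]] := clxy _ _ (cf x U fU) (cf y V fV); exists (f w).
apply: contrapT => /dist[z []]; apply.
  by apply: (fxy (fun w => d w z)); exact: bounded_topology_continuous_distl.
apply: (fxy (fun w => d z w)); rewrite -bounded_topology_flip.
exact: (@bounded_topology_continuous_distl (fun x y => d y x)).
Qed.

(* [near_dist_uniform] gives such a neighbourhood U of x for an admissible
   topology only.  The part of the compact first projection of [Ieps d (e / 2)]
   outside of U is covered by finitely many sets separated from x in the bounded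
   topology, and off this projection d(x', .) is smaller than e / 2. *)
Lemma near_bounded_topology_uniform d (x : X) (e : R) :
  bounded_lorentzian_metric_space d -> 0 < e ->
  \forall x' \near (x : topologized (bounded_topology d)),
    forall z, `|d x' z - d x z| < e.
Proof.
move=> [d0 _ [T aT] dist] e0; have [cd cI] := aT.
pose B := topologized (bounded_topology d).
have e20 : 0 < e / 2 by lra.
have BT : opens (bounded_topology d) `<=` opens T by move=> A; exact.
have /compact_near_coveringP cov := cI _ e20.
(* The claim is tested only on pairs starting at x'. Near a pair (y,z) with y different from x it
   becomes vacuous by separation. For y = x the equality turns a neighbourhood of x in [T] into a
   condition on x'. *)
pose P (x' : B) (w : topologized T * topologized T) :=
  w.1 = x' -> forall z, `|d x' z - d x z| < e.
have nP : \forall x' \near (x : B), Ieps d (e / 2) `<=` P x'.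
  apply: (cov _ _ P (nbhs_filter (x : B))) => -[y z] /= _.
  have [yx|yx] := pselect (y = x).
    have := near_dist_uniform x d0 aT e0; rewrite -{1}yx => nA.
    exists ((fun x' => forall z, `|d x' z - d x z| < e) `*` setT, setT).
      split=> //=; last exact: filterT.
      by eexists (_, setT); [split; [exact: nA|exact: filterT]|].
    by move=> [[y' z'] x'] [/= [+ _] _]; rewrite /P /= => + y'x'; rewrite -y'x'.
  have := bounded_topology_hausdorff dist; rewrite open_hausdorff.
  move=> /(_ y x) []; first exact/eqP.
  move=> [U V] /= [/set_mem Uy /set_mem Vx] [oU oV /eqP UV0].
  exists (U `*` setT, V).
    split=> /=; last by apply: open_nbhs_nbhs.
    exists (U, setT) => //; split; last exact: filterT.
    by apply: open_nbhs_nbhs; split => //; exact: BT.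
  move=> [[y' z'] x'] [/= [Uy' _] Vx'] yx'; rewrite /= in yx'; subst y'.
  by have : (U `&` V) x' by []; rewrite UV0.
(* If d(x,.) exceeds e/2 at z0, so does d(x',.) for x' near x, which puts x' in the first
   projection. Otherwise d(x,.) is at most e/2 everywhere. *)
have [[z0 xz0]|xz] := pselect (exists z, e / 2 < d x z).
  have nz0 : \forall x' \near (x : B), e / 2 < d x' z0.
    have := @bounded_topology_continuous_distl d z0 x.
    by move=> /(cvgr_gt (d x z0)); exact.
  apply: filterS2 nP nz0 => x' Px' x'z0.
  exact: (Px' (x', z0) (ltW x'z0) erefl).
apply: filterS nP => x' Px' z.
have [xz'|xz'] := leP (e / 2) (d x' z).
  exact: (Px' (x', z) xz' erefl).
have : d x z <= e / 2 by rewrite leNgt; apply/negP => ?; apply: xz; exists z.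
by have := d0 x z; have := d0 x' z; rewrite ltr_norml; lra.
Qed.

Lemma bounded_lorentzian_metric_space_flip d :
  bounded_lorentzian_metric_space d ->
  bounded_lorentzian_metric_space (fun x y => d y x).
Proof.
move=> [d0 tri [T aT] dist]; split=> //.
- by move=> x y z yx zy; rewrite addrC; exact: tri.
- by exists T; exact: bounded_admissible_flip.
- by move=> x y /dist[z [?|?]]; exists z; [right|left].
Qed.

Lemma dense_uniform_approx d (A : set X) (x : X) (e : R) :
  bounded_lorentzian_metric_space d ->
  dense (A : set (topologized (bounded_topology d))) -> 0 < e ->
  exists2 x', A x' & forall z, `|d x' z - d x z| < e /\ `|d z x' - d z x| < e.
Proof.
move=> bd dA e0.
have := near_bounded_topology_uniform x bd e0.
have := near_bounded_topology_uniform x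
  (bounded_lorentzian_metric_space_flip bd) e0.
rewrite bounded_topology_flip => nr nl.
have [x' Ax' [lx' rx']] : exists2 x', A x' &
    (forall z, `|d x' z - d x z| < e) /\ (forall z, `|d z x' - d z x| < e).
  pose F := nbhs_filter (x : topologized (bounded_topology d)).
  have := @filterI _ _ F _ _ nl nr; rewrite nbhsE => -[U [oU Ux] UP].
  have [x' [Ux' Ax']] : U `&` A !=set0 by apply: dA; [exists x|exact: oU].
  by exists x' => //; exact: UP.
by exists x' => // z; split.
Qed.

End bounded.

(** * The chronological interior as a Lorentzian metric space with generating sequences *)

Section restricted.
Context {R : realType} {X : Type}.
Variable d : X -> X -> R.
Hypothesis bd : bounded_lorentzian_metric_space d.
Hypothesis dense_interior :
  dense (chron_interior d : set (topologized (bounded_topology d))).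

Local Notation I := (chron_interior d).
Local Notation val_topology T := (preimage_topology (@set_val X I) T).

Lemma chron_interior_range : I `<=` range (@set_val X I).
Proof. by move=> x Ix; exists (SigSub (mem_set Ix)). Qed.

Lemma restricted_admissible T : bounded_admissible d T ->
  lms_admissible (restricted_dist d) (val_topology T).
Proof.
move: bd => [d0 tri _ _] [cd cI]; split.
  pose S := topologized (val_topology T).
  rewrite /continuous_dist /restricted_dist.
  have cval := @continuous_preimage_topology _ _ (@set_val X I) T.
  apply: (@continuous_dist_comp _ _ d T (S * S)%type (fun z => set_val z.1)
    (fun z => set_val z.2)) => //.
    exact: (continuous_fst_comp cval).
  exact: (continuous_snd_comp cval).
move=> x y e e0 /=; set A := closure_in _ _.
have [[px _ pxx] [qx _ xqx]] := set_valP x.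
have [[py _ pyy] [qy _ yqy]] := set_valP y.
have cl p : continuous (fun z : topologized T => d p z).
  exact: (@continuous_distl _ _ _ T p (bounded_admissible_flip (conj cd cI)).1).
have cr p : continuous (fun z : topologized T => d z p).
  exact: continuous_distl.
(* By the reverse triangle inequality, a point after x is at distance at least d(px,x) > 0 from px,
   and similarly for y and for the future. These bounds are closed conditions, so they survive in
   the closure, and they force membership in the interior. *)
pose K : set (topologized T) :=
  ([set z | d px (set_val x) <= d px z] `|` [set z | d py (set_val y) <= d py z])
  `&` ([set z | d (set_val x) qx <= d z qx] `|` [set z | d (set_val y) qy <= d z qy]).
have closedK : closed K.
  by apply: closedI; apply: closedU; exact: closed_ge_comp.
have KI : K `<=` I.
  move=> z [Kl Kr]; split.
    by case: Kl => /= h; [exists px|exists py] => //; exact: lt_le_trans h.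
  by case: Kr => /= h; [exists qx|exists qy] => //; exact: lt_le_trans h.
have cval := @continuous_preimage_topology _ _ (@set_val X I) T.
have AK : A `<=` set_val @^-1` K.
  have closedvK : closed (set_val @^-1` K : set (topologized (val_topology T))).
    by apply: preimage_closed => // z _; exact: cval.
  rewrite (proj1 (closure_id _) closedvK).
  apply: (@closureS (topologized (val_topology T))) => z [[u uxy uz] [v vxy zv]]; split.
    case: uxy uz => -> uz; [left|right]; rewrite /=.
      by have := tri _ _ _ pxx uz; have := d0 (set_val x) (set_val z); lra.
    by have := tri _ _ _ pyy uz; have := d0 (set_val y) (set_val z); lra.
  case: vxy zv => -> zv; [left|right]; rewrite /=.
    by have := tri _ _ _ zv xqx; have := d0 (set_val z) (set_val x); lra.
  by have := tri _ _ _ zv yqy; have := d0 (set_val z) (set_val y); lra.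
have cK : compact (Ieps d e `&` (K `*` K) : set (topologized T * topologized T)).
  apply: compact_closedI; first exact: cI.
  exact: closed_setX.
have KI2 : Ieps d e `&` (K `*` K) `<=` range (@set_val X I) `*` range (@set_val X I).
  by move=> z [_ [/KI Iz1 /KI Iz2]]; split; exact: chron_interior_range.
have closedA : closed (A : set (topologized (val_topology T))).
  exact: closed_closure.
have closedAA : closed (A `*` A :
    set (topologized (val_topology T) * topologized (val_topology T))).
  exact: closed_setX.
have := compact_closedI (compact_preimage2
  (@subset_refl _ (val_topology T)) (@subset_refl _ (val_topology T)) KI2 cK) closedAA.
congr (compact _); apply/seteqP; split=> [z [[zd _] zA]//|z [zd [A1 A2]]].
by split=> //; split=> //; split; exact: AK.
Qed.

(** This inclusion suffices to transfer compactness, which passes to coarser topologies. *)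
Lemma lms_topology_coarser T : bounded_admissible d T ->
  opens (lms_topology (restricted_dist d)) `<=` opens (val_topology T).
Proof. by move=> /restricted_admissible aT U; exact. Qed.

Lemma restricted_lms : lorentzian_metric_space (restricted_dist d).
Proof.
have [d0 tri [T aT] dist] := bd; split.
- by move=> x y; exact: d0.
- by move=> x y z; exact: tri.
- by exists (val_topology T); exact: restricted_admissible.
move=> x y xy.
(* No number is within half of |a - b| of both a and b, so a point of the interior uniformly that
   close to a distinguishing z still distinguishes. *)
have half (a b : R) : a <> b -> 0 < `|a - b| / 2 /\
    forall w, `|w - a| < `|a - b| / 2 -> `|w - b| < `|a - b| / 2 -> False.
  move=> /eqP ab; split; first by rewrite divr_gt0// normr_gt0 subr_eq0.
  move=> w wa wb; have := ler_distD w a b.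
  by rewrite leNgt => /negP; apply; rewrite (distrC a w); lra.
have /dist[z [|]] : set_val x <> set_val y by move=> /val_inj.
  move=> /half[e0 close].
  have [_ /chron_interior_range[w _ <-] zw] :=
    dense_uniform_approx z bd dense_interior e0.
  exists w; left; rewrite /restricted_dist => eqw.
  apply: (close (d (set_val x) (set_val w))).
    by have [] := zw (set_val x).
  by have [_] := zw (set_val y); rewrite -eqw.
move=> /half[e0 close].
have [_ /chron_interior_range[w _ <-] zw] :=
  dense_uniform_approx z bd dense_interior e0.
exists w; right; rewrite /restricted_dist => eqw.
apply: (close (d (set_val w) (set_val x))).
  by have [] := zw (set_val x).
by have [] := zw (set_val y); rewrite -eqw.
Qed.

Lemma chron_interior_past (x y : X) : 0 < d x y ->
  exists u : I, 0 < d (set_val u) y.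
Proof.
move=> xy; have [_ /chron_interior_range[u _ <-] xu] :=
  dense_uniform_approx x bd dense_interior xy.
by exists u; have [+ _] := xu y; rewrite ltr_norml; lra.
Qed.

Lemma chron_interior_future (x y : X) : 0 < d x y ->
  exists u : I, 0 < d x (set_val u).
Proof.
move=> xy; have [_ /chron_interior_range[u _ <-] yu] :=
  dense_uniform_approx y bd dense_interior xy.
by exists u; have [_] := yu x; rewrite ltr_norml; lra.
Qed.

Lemma generating_exists (u0 : I) : exists p, generating (restricted_dist d) p.
Proof.
have [_ _ [T [cd cI]] _] := bd.
have cl p : continuous (fun z : topologized T => d p z).
  exact: (@continuous_distl _ _ _ T p (bounded_admissible_flip (conj cd cI)).1).
have cr p : continuous (fun z : topologized T => d z p).
  exact: continuous_distl.
pose f (w : {classic I * I}) : set (topologized T * topologized T) :=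
  [set z | 0 < d (set_val w.1) z.2] `&` [set z | 0 < d z.1 (set_val w.2)].
have of_ w : open (f w).
  apply: openI.
    apply: (@open_gt_comp R (topologized T * topologized T)%type
      (fun z => d (set_val w.1) z.2)).
    exact: continuous_snd_comp (cl _).
  apply: (@open_gt_comp R (topologized T * topologized T)%type
    (fun z => d z.1 (set_val w.2))).
  exact: continuous_fst_comp (cr _).
have cover k : exists s : seq {classic I * I}, forall z, Ieps d k.+1%:R^-1 z ->
    exists2 w, w \in s & f w z.
  have k0 : 0 < k.+1%:R^-1 :> R by rewrite invr_gt0.
  apply: (compact_finite_cover (cI _ k0) of_) => z /(lt_le_trans k0) h.
  have [u uz] := chron_interior_past h.
  have [v zv] := chron_interior_future h.
  by exists (u, v).
have {cover}[s sP] := choice cover.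
(* An index codes a pair (k,j): j/2 selects a pair in the k-th finite cover, and the parity of j
   selects its first or second component. Thus all components of all covers are enumerated, and [u0]
   is the default past the end of a list. *)
pose p n : I := let kj := odflt (0, 0)%N (unpickle n) in
  let w := nth (u0, u0) (s kj.1) kj.2./2 in if odd kj.2 then w.1 else w.2.
have pP z : 0 < d z.1 z.2 -> exists i j,
    0 < d (set_val (p i)) z.2 /\ 0 < d z.1 (set_val (p j)).
  move=> z0; have [k] := ltr_add_invr z0; rewrite add0r => /ltW /sP[w ws [fw1 fw2]].
  exists (pickle (k, (index w (s k)).*2.+1)), (pickle (k, (index w (s k)).*2)).
  rewrite /p !pickleK /= odd_double /= uphalf_double doubleK.
  by rewrite [nth _ _ _](nth_index ((u0, u0) : {classic I * I}) ws).
exists p; apply/seteqP; split=> // x _.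
have [[a _ ax] [b _ xb]] := set_valP x.
have [i [_ [pi _]]] := pP (a, set_val x) ax.
have [_ [j [_ pj]]] := pP (set_val x, b) xb.
by split; [exists (p i)|exists (p j)].
Qed.

End restricted.

(** * Chronological sets generated by a set of points *)

Lemma Ieps_of_Iset (R : realType) (Y : Type) (f : Y -> Y -> R) (A : set Y)
    (e : R) :
  0 < e -> Ieps_of f e A `<=` Iset f A.
Proof.
move=> e0 x [y [z [Ay Az yx xz]]].
by split; [exists y|exists z] => //; exact: lt_le_trans e0 _.
Qed.

Lemma Ieps_of_restricted (R : realType) (Y : Type) (f : Y -> Y -> R)
    (A : set (chron_interior f)) (e : R) (x : chron_interior f) :
  Ieps_of f e (set_val @` A) (set_val x) <-> Ieps_of (restricted_dist f) e A x.
Proof.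
split=> [[_ [_ [[y Ay <-] [z Az <-] yx xz]]]|[y [z [Ay Az yx xz]]]].
  by exists y, z.
by exists (set_val y), (set_val z); split=> //; apply: imageP.
Qed.

Lemma IsetS (R : realType) (Y : Type) (f : Y -> Y -> R) (A B : set Y) :
  A `<=` B -> Iset f A `<=` Iset f B.
Proof.
move=> AB x [[y Ay yx] [z Az xz]].
by split; [exists y => //; exact: AB|exists z => //; exact: AB].
Qed.

Lemma generatingS (R : realType) (X : Type) (d : X -> X -> R) (p q : nat -> X) :
  range p `<=` range q -> generating d p -> generating d q.
Proof.
rewrite /generating => pq gp; apply/seteqP; split=> // x _.
by apply: (IsetS pq); rewrite gp.
Qed.

(** Finiteness of [A] makes this a closed set, and it lies in the second projection of the compact
    set [Ieps d e]. *)
Lemma compact_Ieps_of (R : realType) (X : Type) (d : X -> X -> R)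
    (T : topology X) (A : set X) (e : R) : bounded_admissible d T ->
  finite_set A -> 0 < e -> compact (Ieps_of d e A : set (topologized T)).
Proof.
move=> aT finA e0; have [cd cI] := aT.
have cl p : continuous (fun z : topologized T => d p z).
  exact: (@continuous_distl _ _ _ T p (bounded_admissible_flip aT).1).
have cr p : continuous (fun z : topologized T => d z p).
  exact: continuous_distl.
have -> : Ieps_of d e A = (\bigcup_(y in A) [set x | e <= d y x])
                      `&` (\bigcup_(y in A) [set x | e <= d x y]).
  by apply/seteqP; split=> [x [y [z [Ay Az yx xz]]]|x [[y Ay yx] [z Az xz]]];
    [split; [exists y|exists z]|exists y, z].
have csnd : compact (snd @` Ieps d e : set (topologized T)).
  apply: continuous_compact (cI _ e0); apply: continuous_subspaceT => z.
  exact: cvg_snd.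
apply: subclosed_compact csnd _.
  apply: (@closedI (topologized T));
    apply: (@closed_bigcup (topologized T) (topologized T)) => // y _.
    exact: closed_ge_comp.
  exact: closed_ge_comp.
by move=> x [[y _ yx] _]; exists (y, x).
Qed.

(** * Distortion and pairs compatible with a correspondence *)

Section distortion.
Context {R : realType} {X X' : Type}.
Variables (d : X -> X -> R) (d' : X' -> X' -> R).
Implicit Types (S : set (X * X')).

Lemma dis_ltP S (e : R) z w : (dis d d' S < e%:E)%E -> S z -> S w ->
  `|d z.1 w.1 - d' z.2 w.2| < e.
Proof.
move=> Se Sz Sw; rewrite -lte_fin; apply: le_lt_trans Se.
rewrite /dis le_max; apply/orP; right; apply: ereal_sup_ubound.
by exists z, w.
Qed.

Lemma dis_le S (e : R) : 0 <= e ->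
  (forall z w, S z -> S w -> `|d z.1 w.1 - d' z.2 w.2| <= e) ->
  (dis d d' S <= e%:E)%E.
Proof.
move=> e0 Se; rewrite /dis ge_max lee_fin e0 /=.
by apply: ge_ereal_sup => _ [z [w [Sz Sw ->]]]; rewrite lee_fin; exact: Se.
Qed.

(* The pairs that may be added to S without spoiling its distortion. *)
Definition close_pairs S (e : R) : set (X * X') := [set z | forall w, S w ->
  `|d z.1 w.1 - d' z.2 w.2| <= e /\ `|d w.1 z.1 - d' w.2 z.2| <= e].

(** With (w.1,u) and (v,z.2) in [S], each of d(z.1,w.1), d'(z.2,u), d(v,w.1), d'(z.2,w.2) differs
    from the next by at most e. *)
Lemma close_pairs_dist S (e : R) z w : correspondence S ->
  (dis d d' S < e%:E)%E -> close_pairs S e z -> close_pairs S e w ->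
  `|d z.1 w.1 - d' z.2 w.2| <= 3 * e.
Proof.
move=> [S1 S2] Se Cz Cw.
have [[y u] Syu /= yw] : (fst @` S) w.1 by rewrite S1.
have [[v x] Svx /= xz] : (snd @` S) z.2 by rewrite S2.
have [+ _] := Cz _ Syu; have [_ +] := Cw _ Svx; have := dis_ltP Se Svx Syu.
by rewrite /= yw xz ltr_norml !ler_norml; lra.
Qed.

Lemma closed_close_pairs S (e : R) (T : topology X) (T' : topology X') :
  bounded_admissible d T -> bounded_admissible d' T' ->
  closed (close_pairs S e : set (topologized T * topologized T')).
Proof.
move=> aT aT'.
have [[cd _] [cd' _]] := (aT, aT').
have [[cf _] [cf' _]] := (bounded_admissible_flip aT, bounded_admissible_flip aT').
have -> : close_pairs S e = \bigcap_(w in S)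
    ([set z | `|d z.1 w.1 - d' z.2 w.2| <= e] `&`
     [set z | `|d w.1 z.1 - d' w.2 z.2| <= e]).
  by apply/seteqP; split.
apply: (@closed_bigI (topologized T * topologized T')%type) => w _.
apply: closedI.
  apply: (@closed_dist_le_comp R (topologized T * topologized T')%type
    (fun z => d z.1 w.1) (fun z => d' z.2 w.2)).
    exact: (continuous_fst_comp (continuous_distl cd)).
  exact: (continuous_snd_comp (continuous_distl cd')).
apply: (@closed_dist_le_comp R (topologized T * topologized T')%type
  (fun z => d w.1 z.1) (fun z => d' w.2 z.2)).
  exact: (continuous_fst_comp (continuous_distl cf)).
exact: (continuous_snd_comp (continuous_distl cf')).
Qed.

End distortion.

(** * Quasi-correspondences from a correspondence of small distortion *)

Section quasi_correspondence.
Context {R : realType} {X X' : Type}.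
Variables (d : X -> X -> R) (d' : X' -> X' -> R).
Hypothesis bd : bounded_lorentzian_metric_space d.
Hypothesis bd' : bounded_lorentzian_metric_space d'.

Lemma quasi_correspondence_exists (S : set (X * X')) (m : nat) (e : R)
    (p : nat -> chron_interior d) (p' : nat -> chron_interior d') :
  correspondence S -> 0 < e -> (dis d d' S < (e / 4)%:E)%E ->
  (forall r, (r < m)%N -> close_pairs d d' S (e / 4) (set_val (p r), set_val (p' r))) ->
  exists Q, quasi_correspondence (restricted_dist d) p (restricted_dist d') p' m e Q.
Proof.
move=> corS e0 Se pS; have [S1 S2] := corS.
have e20 : 0 < e / 2 by lra.
have [_ _ [T aT] _] := bd; have [_ _ [T' aT'] _] := bd'.
have finP (Y : Type) (q : nat -> Y) : finite_set (first_points q m).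
  exact/finite_image/finite_II.
(* The threshold e/2 leaves room for the error e/4: partners of points at level e are at level 3e/4,
   hence still in these sets. *)
pose B := Ieps_of d (e / 2) (set_val @` first_points p m).
pose B' := Ieps_of d' (e / 2) (set_val @` first_points p' m).
have cB : compact (B : set (topologized T)).
  exact: compact_Ieps_of aT (finite_image _ (finP _ p)) e20.
have cB' : compact (B' : set (topologized T')).
  exact: compact_Ieps_of aT' (finite_image _ (finP _ p')) e20.
(* [S] is not assumed closed; [close_pairs] is a closed set that contains it. *)
pose K : set (X * X') := (B `*` B') `&` close_pairs d d' S (e / 4).
have cK : compact (K : set (topologized T * topologized T')).
  apply: compact_closedI; last exact: closed_close_pairs.
  exact: compact_setX.
have KI : K `<=` range (@set_val X (chron_interior d))
              `*` range (@set_val X' (chron_interior d')).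
  move=> z [[Bz Bz'] _]; split; apply: chron_interior_range.
    by apply: IsetS (Ieps_of_Iset e20 Bz).
  by apply: IsetS (Ieps_of_Iset e20 Bz').
pose Q1 := [set z : chron_interior d * chron_interior d' | K (set_val z.1, set_val z.2)].
pose Q2 := [set z | exists2 r, (r < m)%N & z = (p r, p' r)].
have cQ1 : compact (Q1 : set (topologized (lms_topology (restricted_dist d)) *
                              topologized (lms_topology (restricted_dist d')))).
  apply: compact_preimage2 KI cK; exact: lms_topology_coarser.
have cQ2 : compact (Q2 : set (topologized (lms_topology (restricted_dist d)) *
                              topologized (lms_topology (restricted_dist d')))).
  apply: finite_compact; have -> : Q2 = (fun r => (p r, p' r)) @` `I_m.
    by apply/seteqP; split=> [_ [r rm ->]|_ [r rm <-]]; exists r.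
  exact/finite_image/finite_II.
have closeQ z : (Q1 `|` Q2) z -> close_pairs d d' S (e / 4) (set_val z.1, set_val z.2).
  by move=> [[_]//|[r rm ->]]; exact: pS.
have closeS z : S z -> close_pairs d d' S (e / 4) z.
  by move=> Sz w Sw; split; apply: ltW; exact: dis_ltP Se _ _.
exists (Q1 `|` Q2); split.
- split; first exact: compactU.
  move=> z [[[/Ieps_of_restricted Bz /Ieps_of_restricted Bz'] _]|[r rm ->]]; last first.
    by split; right; exists r.
  split; left; apply: subset_closure; exact: Ieps_of_Iset e20 _ _.
(* An [S]-partner x' of x may a priori lie outside the interior. Closeness of the marked pairs i and
   j to [S] places it in [B'], hence inside. *)
- move=> x [_ [_ [[i im <-] [j jm <-] ix xj]]]; rewrite /restricted_dist in ix xj.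
  have [[y x'] Sx /= yx] : (fst @` S) (set_val x) by rewrite S1.
  subst y; have [[+ _] [_ +]] := (pS i im _ Sx, pS j jm _ Sx).
  rewrite /= !ler_norml => ix' xj'.
  have B'x : B' x'.
    exists (set_val (p' i)), (set_val (p' j)).
    by split; [exists (p' i) => //; exists i|exists (p' j) => //; exists j|lra|lra].
  have [u' _ u'x'] :=
    chron_interior_range (IsetS (@subsetT _ _) (Ieps_of_Iset e20 B'x)).
  exists (x, u') => //; left; split => /=; last by rewrite u'x'; exact: closeS.
  split; rewrite /= ?u'x' //; apply/Ieps_of_restricted.
  exists (p i), (p j); split; [by exists i|by exists j| |];
    by rewrite /restricted_dist; lra.
- move=> x' [_ [_ [[i im <-] [j jm <-] ix xj]]]; rewrite /restricted_dist in ix xj.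
  have [[x y] Sx /= yx] : (snd @` S) (set_val x') by rewrite S2.
  subst y; have [[+ _] [_ +]] := (pS i im _ Sx, pS j jm _ Sx).
  rewrite /= !ler_norml => ix' xj'.
  have Bx : B x.
    exists (set_val (p i)), (set_val (p j)).
    by split; [exists (p i) => //; exists i|exists (p j) => //; exists j|lra|lra].
  have [u _ ux] :=
    chron_interior_range (IsetS (@subsetT _ _) (Ieps_of_Iset e20 Bx)).
  exists (u, x') => //; left; split => /=; last by rewrite ux; exact: closeS.
  split; rewrite /= ?ux //; apply/Ieps_of_restricted.
  exists (p' i), (p' j); split; [by exists i|by exists j| |];
    by rewrite /restricted_dist; lra.
- apply: (@le_lt_trans _ _ (3 * (e / 4))%:E); last by rewrite lte_fin; lra.
  apply: dis_le; first by lra.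
  by move=> z w /closeQ Cz /closeQ Cw; exact: close_pairs_dist corS Se Cz Cw.
- by move=> r rm; right; exists r.
Qed.

End quasi_correspondence.

(** * Choice of the generating sequences and convergence *)

Theorem proposition6p16 (R : realType)
  (X_ : nat -> Type) (d_ : forall n, X_ n -> X_ n -> R)
  (X : Type) (d : X -> X -> R)
  (hX_ : forall n, bounded_lorentzian_metric_space (d_ n))
  (hX : bounded_lorentzian_metric_space d)
  (hcvg : bounded_GH_converges d_ d)
  (hdense_ : forall n,
     dense (chron_interior (d_ n) : set (topologized (bounded_topology (d_ n)))))
  (hdense : dense (chron_interior d : set (topologized (bounded_topology d))))
  (p : nat -> chron_interior d)
  (hp : generating (restricted_dist d) p) :
  exists p_ : forall n, nat -> chron_interior (d_ n),
    [/\ forall n, sequenced_lorentzian_metric_space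
          (restricted_dist (d_ n)) (p_ n),
        sequenced_lorentzian_metric_space (restricted_dist d) p
      & sequenced_GH_converges
          (fun n => restricted_dist (d_ n)) p_
          (restricted_dist d) p].
Proof.
have [S [corS cvgS]] := hcvg.
have approx n k : {a : chron_interior (d_ n) | exists2 x, S n (x, set_val (p k)) &
    forall z, `|d_ n (set_val a) z - d_ n x z| < n.+1%:R^-1 /\
              `|d_ n z (set_val a) - d_ n z x| < n.+1%:R^-1}.
  apply: cid; have [_ S2] := corS n.
  have [[x y] Sx /= yp] : (snd @` S n) (set_val (p k)) by rewrite S2.
  have n0 : 0 < n.+1%:R^-1 :> R by rewrite invr_gt0.
  have [x' /(@chron_interior_range _ _ (d_ n))[a _ ax'] xx'] :=
    dense_uniform_approx x (hX_ n) (hdense_ n) n0.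
  by exists a; exists x => [|z]; rewrite ?ax' -?yp.
pose a n k := sval (approx n k).
(* The point [a n 0] witnesses that the interior is nonempty. *)
have q n := cid (generating_exists (hX_ n) (hdense_ n) (a n 0)).
(* The shift by n keeps every term of [q n], so the sequence still generates, while for fixed m its
   first m terms are the approximations as soon as n is at least m. *)
pose p_ n k := if (k < n)%N then a n k else sval (q n) (k - n)%N.
exists p_; split.
- move=> n; split; first exact: restricted_lms (hX_ n) (hdense_ n).
  apply: (generatingS _ (svalP (q n))) => u [k _ qk].
  by exists (k + n)%N => //; rewrite -qk /p_ ltnNge leq_addl addnK.
- by split; first exact: restricted_lms.
move=> m e e0.
(* One e/8 bounds the distortion of [S n], the other the displacement 1/(n+1) into the interior.
   Together they give the tolerance e/4 required of the marked pairs. *)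
have e80 : 0 < e / 8 by lra.
have : \forall n \near \oo, (dis (@d_ n) d (S n) < (e / 8)%:E)%E.
  apply: (cvgS [set x | (x < (e / 8)%:E)%E]); apply: open_nbhs_nbhs.
  split; last by rewrite /= lte_fin.
  exact: open_ereal_lt_ereal.
move=> [n1 _ dis_n]; have [n2] := ltr_add_invr e80; rewrite add0r => n2e.
exists (maxn m (maxn n1 n2)) => n; rewrite !geq_max => /and3P[mn n1n n2n].
have ne : n.+1%:R^-1 < e / 8.
  by apply: le_lt_trans n2e; rewrite lef_pV2 ?posrE// ler_nat.
have Sn : (dis (@d_ n) d (S n) < (e / 8)%:E)%E by exact: dis_n.
apply: (quasi_correspondence_exists (hX_ n) hX (corS n) e0).
  by apply: lt_trans Sn _; rewrite lte_fin; lra.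
move=> r rm w Sw; rewrite /p_ (leq_trans rm mn) /=.
have [x Sx xa] := svalP (approx n r); rewrite -/(a n r) in xa.
have [/lt_trans/(_ ne) + /lt_trans/(_ ne)] := xa w.1.
have := dis_ltP Sn Sx Sw; have := dis_ltP Sn Sw Sx.
by rewrite /= !ltr_norml !ler_norml => ? ? ? ?; split; lra.
Qed.
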